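(* For any $n, k, d, d_0 \in \mathbb{N}$ with $d_0 \le d$ and any $\epsilon, \delta > 0$, there exists a one-query $(O(\epsilon d_0), \delta')$-steward for $k$ adaptively chosen $(\epsilon,\delta)$-concentrated functions $f_1,\dots,f_k: \{0,1\}^n \to \mathbb{R}^d$ with randomness complexity $n$, where \[ \delta' \le \exp\left(O\left(\frac{kd\log(d_0+1)}{d_0}\right)\right)\cdot\delta. \] The total running time of the steward is $\mathrm{poly}(n,k,d,\log(1/\epsilon))$.
   Context: A function $f: \{0,1\}^n \to \mathbb{R}^d$ is $(\epsilon,\delta)$-concentrated at $\mu \in \mathbb{R}^d$ if $\Pr_{X}[\|f(X) - \mu\|_\infty > \epsilon] \le \delta$ for uniform $X\in\{0,1\}^n$. An $(\epsilon', \delta')$-steward for $k$ adaptively chosen $(\epsilon,\delta)$-concentrated functions is a randomized algorithm $\mathsf{S}$ interacting with an arbitrary (possibly randomized) owner $\mathsf{O}$: for $i = 1,\dots,k$, $\mathsf{O}$ adaptively chooses $f_i$ that is $(\epsilon,\delta)$-concentrated at some $\mu_i\in\mathbb{R}^d$ and gives it to $\mathsf{S}$, which returns $Y_i \in \mathbb{R}^d$; for every $\mathsf{O}$, $\Pr[\max_i \|Y_i - \mu_i\|_\infty > \epsilon'] \le \delta'$. It is one-query if it accesses each $f_i$ only by evaluating it at a single point $X_i$ (not seen by the owner). Randomness complexity is the number of random bits used by the steward. $O(\cdot)$ constants are absolute. *)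

(* Defs.v *)
From HB Require Import structures.
From mathcomp Require Import all_boot all_order all_algebra.
From mathcomp Require Import all_classical all_reals all_analysis.

Set Implicit Arguments.
Unset Strict Implicit.
Unset Printing Implicit Defensive.

Import Order.TTheory GRing.Theory Num.Theory.
Import numFieldNormedType.Exports.

Local Open Scope ring_scope.

(* The library norm `|v| of v : 'rV[R]_d is the max norm. *)
Definition concentrated (R : realType) (n d : nat) (eps delta : R)
    (f : n.-tuple bool -> 'rV[R]_d) (mu : 'rV[R]_d) : bool :=
  #|[set X : n.-tuple bool | eps < `|f X - mu|]|%:R / (2 ^ n)%:R <= delta.

(* A deterministic owner: given the answers Y_1, ..., Y_(i-1) it has received so
   far, it picks the next function f_i together with the point mu_i at which
   f_i is concentrated.  A randomized owner is a family of such strategies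
   indexed by a probability space; see [is_steward]. *)
Definition strategy (R : realType) (n d : nat) : Type :=
  seq 'rV[R]_d -> (n.-tuple bool -> 'rV[R]_d) * 'rV[R]_d.

Definition admissible (R : realType) (n d k : nat) (eps delta : R)
    (O : strategy R n d) : Prop :=
  forall h : seq 'rV[R]_d, (size h < k)%N ->
    concentrated eps delta (O h).1 (O h).2.

(* Stewards are programs for a real RAM: a bank of natural-number cells and a
   bank of real cells, both indirectly addressed.  Programs contain no real
   constants, and natural numbers can only be added and subtracted. *)
Inductive nexp : Type :=
| NConst of nat
| NCell of nexp
| NAdd of nexp & nexp
| NSub of nexp & nexp.

Inductive rexp : Type :=
| RCell of nexp
| ROfNat of nexp
| RAdd of rexp & rexp
| RSub of rexp & rexp
| RMul of rexp & rexp
| RDiv of rexp & rexp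
| RFloor of rexp.

Inductive bexp : Type :=
| NLe of nexp & nexp
| RLe of rexp & rexp
| BNot of bexp
| BAnd of bexp & bexp.

(* [Flip a] stores a fresh random bit in natural-number cell [a].
   [Query a b] evaluates the current function f_i at the point of {0,1}^n
   stored in natural-number cells a, ..., a+n-1 (nonzero meaning 1) and stores
   the d coordinates of the value in real cells b, ..., b+d-1.
   [Answer b] returns the vector in real cells b, ..., b+d-1 to the owner as
   Y_i; f_(i+1) then becomes the current function. *)
Inductive prog : Type :=
| Skip
| NSet of nexp & nexp
| RSet of nexp & rexp
| Seq of prog & prog
| If of bexp & prog & prog
| While of bexp & prog
| Flip of nexp
| Query of nexp & nexp
| Answer of nexp.

Fixpoint nsize (e : nexp) : nat :=
  match e with
  | NConst _ => 1
  | NCell a => (nsize a).+1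
  | NAdd e1 e2 | NSub e1 e2 => (nsize e1 + nsize e2).+1
  end.

Fixpoint rsize (e : rexp) : nat :=
  match e with
  | RCell a | ROfNat a => (nsize a).+1
  | RAdd e1 e2 | RSub e1 e2 | RMul e1 e2 | RDiv e1 e2 =>
      (rsize e1 + rsize e2).+1
  | RFloor e1 => (rsize e1).+1
  end.

Fixpoint bsize (b : bexp) : nat :=
  match b with
  | NLe e1 e2 => (nsize e1 + nsize e2).+1
  | RLe e1 e2 => (rsize e1 + rsize e2).+1
  | BNot b1 => (bsize b1).+1
  | BAnd b1 b2 => (bsize b1 + bsize b2).+1
  end.

(* [coins] is the part of the random tape not read yet, [answers] the vectors
   returned so far, and [queries] has, for each query made so far, the (0-based)
   index of the function that was queried. *)
Record state (R : realType) (d : nat) : Type := State {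
  nmem : nat -> nat;
  rmem : nat -> R;
  coins : seq bool;
  answers : seq 'rV[R]_d;
  queries : seq nat }.

Section Semantics.
Variables (R : realType) (n d : nat).
Implicit Types (s : state R d).

Fixpoint neval s (e : nexp) : nat :=
  match e with
  | NConst c => c
  | NCell a => nmem s (neval s a)
  | NAdd e1 e2 => (neval s e1 + neval s e2)%N
  | NSub e1 e2 => (neval s e1 - neval s e2)%N
  end.

Fixpoint reval s (e : rexp) : R :=
  match e with
  | RCell a => rmem s (neval s a)
  | ROfNat a => (neval s a)%:R
  | RAdd e1 e2 => reval s e1 + reval s e2
  | RSub e1 e2 => reval s e1 - reval s e2
  | RMul e1 e2 => reval s e1 * reval s e2
  | RDiv e1 e2 => reval s e1 / reval s e2
  | RFloor e1 => (Num.floor (reval s e1))%:~R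
  end.

Fixpoint beval s (b : bexp) : bool :=
  match b with
  | NLe e1 e2 => (neval s e1 <= neval s e2)%N
  | RLe e1 e2 => reval s e1 <= reval s e2
  | BNot b1 => ~~ beval s b1
  | BAnd b1 b2 => beval s b1 && beval s b2
  end.

Definition set_nmem s (a v : nat) : state R d :=
  State [eta nmem s with a |-> v] (rmem s) (coins s) (answers s) (queries s).

Definition set_rmem s (a : nat) (v : R) : state R d :=
  State (nmem s) [eta rmem s with a |-> v] (coins s) (answers s) (queries s).

Definition set_coins s (c : seq bool) : state R d :=
  State (nmem s) (rmem s) c (answers s) (queries s).

Definition read_point s (a : nat) : n.-tuple bool :=
  [tuple nmem s (a + i) != 0%N | i < n].

Definition read_vector s (b : nat) : 'rV[R]_d := \row_(j < d) rmem s (b + j).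

Definition write_vector (m : nat -> R) (b : nat) (v : 'rV[R]_d) : nat -> R :=
  fun c => if (b <= c)%N
           then if insub (c - b)%N is Some j then v ord0 j else m c
           else m c.

Definition do_query (O : strategy R n d) s (a b : nat) : state R d :=
  State (nmem s)
    (write_vector (rmem s) b ((O (answers s)).1 (read_point s a)))
    (coins s) (answers s) (rcons (queries s) (size (answers s))).

Definition do_answer s (b : nat) : state R d :=
  State (nmem s) (rmem s) (coins s)
    (rcons (answers s) (read_vector s b)) (queries s).

(* [exec O p s t s']: against the owner O, program p started in state s halts
   in state s' after t time units.  Every operation costs one unit, except that
   transferring a point of {0,1}^n or a vector of R^d costs n or d units.
   There is no rule for flipping a coin on an exhausted tape. *)
Inductive exec (O : strategy R n d) :
    prog -> state R d -> nat -> state R d -> Prop :=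
| exec_skip s : exec O Skip s 1 s
| exec_nset a e s :
    exec O (NSet a e) s (nsize a + nsize e).+1
      (set_nmem s (neval s a) (neval s e))
| exec_rset a e s :
    exec O (RSet a e) s (nsize a + rsize e).+1
      (set_rmem s (neval s a) (reval s e))
| exec_seq p1 p2 s1 s2 s3 t1 t2 :
    exec O p1 s1 t1 s2 -> exec O p2 s2 t2 s3 ->
    exec O (Seq p1 p2) s1 (t1 + t2) s3
| exec_if_true b p1 p2 s s' t :
    beval s b -> exec O p1 s t s' ->
    exec O (If b p1 p2) s (bsize b + t).+1 s'
| exec_if_false b p1 p2 s s' t :
    ~~ beval s b -> exec O p2 s t s' ->
    exec O (If b p1 p2) s (bsize b + t).+1 s'
| exec_while_true b p s1 s2 s3 t1 t2 :
    beval s1 b -> exec O p s1 t1 s2 -> exec O (While b p) s2 t2 s3 ->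
    exec O (While b p) s1 (bsize b + t1 + t2).+1 s3
| exec_while_false b p s :
    ~~ beval s b -> exec O (While b p) s (bsize b).+1 s
| exec_flip a s c cs :
    coins s = c :: cs ->
    exec O (Flip a) s (nsize a).+1
      (set_coins (set_nmem s (neval s a) c) cs)
| exec_query a b s :
    exec O (Query a b) s (nsize a + nsize b + n + d).+1
      (do_query O s (neval s a) (neval s b))
| exec_answer b s :
    exec O (Answer b) s (nsize b + d).+1 (do_answer s (neval s b)).

End Semantics.

(* The inputs n, k, d, d0 are in natural-number cells 0 to 3 and eps, delta in
   real cells 0 and 1; all other cells are 0. *)
Definition initial (R : realType) (n k d d0 : nat) (eps delta : R)
    (tape : seq bool) : state R d :=
  State (fun a => nth 0%N [:: n; k; d; d0] a) (fun a => nth 0 [:: eps; delta] a)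
    tape [::] [::].

Section Stewards.
Variables (R : realType) (n k d d0 : nat) (eps delta : R).

(* The run of p on its inputs and a tape of m random bits halts after t time
   units in state s. *)
Definition runs_to (p : prog) (m : nat) (O : strategy R n d)
    (tape : m.-tuple bool) (t : nat) (s : state R d) : Prop :=
  exec O p (initial n k d d0 eps delta tape) t s.

(* max_i `|Y_i - mu_i| > eps' *)
Definition too_far (eps' : R) (O : strategy R n d) (s : state R d) : Prop :=
  exists2 i, (i < k)%N &
    eps' < `|nth 0 (answers s) i - (O (take i (answers s))).2|.

(* p is an (eps', delta')-steward for k adaptively chosen
   (eps, delta)-concentrated functions using m random bits.  The owner's
   randomness w is drawn from an arbitrary probability space, independently of
   the steward's tape.  The failure probability is taken for every owner for
   which failure is an event, i.e. is measurable. *)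
Definition is_steward (eps' delta' : R) (m : nat) (p : prog) : Prop :=
  (forall (O : strategy R n d) (tape : m.-tuple bool),
     admissible k eps delta O ->
     exists t s, runs_to p O tape t s /\ size (answers s) = k) /\
  (forall (disp : measure_display) (T : measurableType disp)
      (P : probability T R) (O : T -> strategy R n d),
     let failure (tape : m.-tuple bool) : set T :=
       [set w | exists t s, runs_to p (O w) tape t s /\ too_far eps' (O w) s]%classic
     in
     (forall w, admissible k eps delta (O w)) ->
     (forall tape, measurable (failure tape)) ->
     ((((2 ^ m)%:R^-1)%:E * \sum_(tape : m.-tuple bool) P (failure tape))%E
        <= delta'%:E)%E).

Definition one_query (m : nat) (p : prog) : Prop :=
  forall (O : strategy R n d) (tape : m.-tuple bool) t s,
    admissible k eps delta O -> runs_to p O tape t s -> uniq (queries s).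

Definition time_at_most (B : R) (m : nat) (p : prog) : Prop :=
  forall (O : strategy R n d) (tape : m.-tuple bool) t s,
    admissible k eps delta O -> runs_to p O tape t s -> t%:R <= B.

End Stewards.

(* Main.v *)
Require Import Defs.
From HB Require Import structures.
From mathcomp Require Import all_boot all_order all_algebra.
From mathcomp Require Import all_classical all_reals all_analysis.
From mathcomp Require Import measurable_realfun unstable zify ring lra.

Set Implicit Arguments.
Unset Strict Implicit.
Unset Printing Implicit Defensive.

Import Order.TTheory GRing.Theory Num.Theory.
Import numFieldNormedType.Exports.

Local Open Scope ring_scope.

(* The steward draws a single X and queries every f_i at it.  It cuts the d
   coordinates into blocks of d0 and rounds each block of f_i(X) + 2 e eps to
   the grid of step 2 (d0 + 1) eps, where the shift e <= d0 is such that no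
   coordinate of the block is within eps of a grid boundary.  Each coordinate
   rules out at most one of the d0 + 1 shifts, so such an e exists.  If f_i(X)
   is within eps of mu_i, then the answer is a function of mu_i and of the
   shifts only.  Hence, until X first falls in the exceptional set of some f_i,
   the answers follow a tree of degree b = (d0 + 1) ^ (number of blocks) that
   depends on the owner but not on X, and a union bound over its at most b ^ k
   nodes bounds the failure probability by b ^ k * delta. *)

(** [one_query], [time_at_most] and the failure event speak of arbitrary halting runs; determinism
    transfers to them what is proved of one constructed run. *)
Lemma exec_deterministic (R : realType) (n d : nat) (O : strategy R n d)
    (p : prog) (s s1 s2 : state R d) (t1 t2 : nat) :
  exec O p s t1 s1 -> exec O p s t2 s2 -> t1 = t2 /\ s1 = s2.
Proof.
move=> e1; elim: e1 t2 s2 => {p s t1 s1}.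
- by move=> s t2 s2 e2; inversion e2.
- by move=> a e s t2 s2 e2; inversion e2.
- by move=> a e s t2 s2 e2; inversion e2.
- move=> p1 p2 s1 s2 s3 t1 t2 _ IH1 _ IH2 t s e2; inversion e2; subst.
  match goal with H1 : exec O p1 s1 _ _, H2 : exec O p2 _ _ s |- _ =>
    by case: (IH1 _ _ H1) => -> E; rewrite -E in H2; case: (IH2 _ _ H2) => -> ->
  end.
- move=> b p1 p2 s s1 t1 hb _ IH t2 s2 e2; inversion e2; subst.
    by match goal with H : exec O p1 s _ _ |- _ => case: (IH _ _ H) => -> -> end.
  by match goal with H : is_true (~~ _) |- _ => rewrite hb in H end.
- move=> b p1 p2 s s1 t1 hb _ IH t2 s2 e2; inversion e2; subst.
    by match goal with H : is_true (beval s b) |- _ => rewrite H in hb end.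
  by match goal with H : exec O p2 s _ _ |- _ => case: (IH _ _ H) => -> -> end.
- move=> b p s1 s2 s3 t1 t2 hb _ IH1 _ IH2 t s e2; inversion e2; subst.
    match goal with H1 : exec O p s1 _ _, H2 : exec O (While b p) _ _ s |- _ =>
      by case: (IH1 _ _ H1) => -> E; rewrite -E in H2; case: (IH2 _ _ H2) => -> ->
    end.
  by match goal with H : is_true (~~ _) |- _ => rewrite hb in H end.
- move=> b p s hb t2 s2 e2; inversion e2; subst => //.
  by match goal with H : is_true (beval s b) |- _ => rewrite H in hb end.
- move=> a s c cs hc t2 s2 e2; inversion e2; subst.
  by match goal with H : coins s = _ |- _ => move: H; rewrite hc => -[-> ->] end.
- by move=> a b s t2 s2 e2; inversion e2.
- by move=> b s t2 s2 e2; inversion e2.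
Qed.

(** * A total-correctness calculus with time bounds *)

Section TotalCorrectness.
Variables (R : realType) (n d : nat) (O : strategy R n d).
Implicit Types (s : state R d) (Q : state R d -> Prop) (p : prog).

Definition wp p (B : nat) s Q : Prop :=
  exists t s', [/\ exec O p s t s', (t <= B)%N & Q s'].

Lemma wp_consequence p B B' s Q Q' :
  wp p B s Q -> (B <= B')%N -> (forall s', Q s' -> Q' s') -> wp p B' s Q'.
Proof.
move=> [t [s' [e hB q]]] hBB hQ; exists t, s'; split; [by []| | exact: hQ].
exact: leq_trans hBB.
Qed.

Lemma wp_seq p1 p2 B1 B2 s Q :
  wp p1 B1 s (fun s' => wp p2 B2 s' Q) -> wp (Seq p1 p2) (B1 + B2) s Q.
Proof.
move=> [t1 [s1 [e1 h1 [t2 [s2 [e2 h2 q]]]]]]; exists (t1 + t2)%N, s2.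
by split; [exact: exec_seq e1 e2 | exact: leq_add |].
Qed.

Lemma wp_while b p B (I : state R d -> Prop) (m : state R d -> nat) s :
  (forall s, I s -> beval s b ->
     wp p B s (fun s' => I s' /\ (m s' < m s)%N)) ->
  I s ->
  wp (While b p) ((m s).+1 * (bsize b + B).+1) s
     (fun s' => I s' /\ ~~ beval s' b).
Proof.
move=> step; have [N] := ubnP (m s); elim: N s => // N IH s hN hI.
have [hb|hb] := boolP (beval s b); last first.
  exists (bsize b).+1, s; split=> //; first exact: exec_while_false.
  by rewrite mulSn; lia.
have [t1 [s1 [e1 h1 [hI1 hm]]]] := step _ hI hb.
have [t2 [s2 [e2 h2 q]]] := IH s1 (leq_trans hm hN) hI1.
exists (bsize b + t1 + t2).+1, s2; split=> //; first exact: exec_while_true e2.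
have h3 : (((m s1).+1 * (bsize b + B).+1) <= m s * (bsize b + B).+1)%N.
  exact: leq_mul.
by rewrite mulSn; lia.
Qed.

Fixpoint straight p : bool :=
  match p with
  | Seq p1 p2 | If _ p1 p2 => straight p1 && straight p2
  | While _ _ | Flip _ => false
  | _ => true
  end.

(** Loops and coin flips, which may diverge or get stuck, receive the default value [s]; [straight]
    rules them out. *)
Fixpoint run p s : state R d :=
  match p with
  | NSet a e => set_nmem s (neval s a) (neval s e)
  | RSet a e => set_rmem s (neval s a) (reval s e)
  | Seq p1 p2 => run p2 (run p1 s)
  | If b p1 p2 => if beval s b then run p1 s else run p2 s
  | Query a b => do_query O s (neval s a) (neval s b)
  | Answer b => do_answer s (neval s b)
  | Skip | While _ _ | Flip _ => s
  end.

End TotalCorrectness.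

(** Both branches of an [If] are charged, so that the bound does not depend on the state. *)
Fixpoint cost (n d : nat) (p : prog) : nat :=
  match p with
  | Skip | While _ _ | Flip _ => 1
  | NSet a e => (nsize a + nsize e).+1
  | RSet a e => (nsize a + rsize e).+1
  | Seq p1 p2 => cost n d p1 + cost n d p2
  | If b p1 p2 => (bsize b + (cost n d p1 + cost n d p2)).+1
  | Query a b => (nsize a + nsize b + n + d).+1
  | Answer b => (nsize b + d).+1
  end.

Lemma wp_straight (R : realType) (n d : nat) (O : strategy R n d) (p : prog)
    (s : state R d) (Q : state R d -> Prop) :
  straight p -> Q (run O p s) -> wp O p (cost n d p) s Q.
Proof.
move=> hp q; suff [t e ht] : exists2 t, exec O p s t (run O p s) & (t <= cost n d p)%N.
  by exists t, (run O p s).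
elim: p s hp {q} => //=.
- by move=> s _; exists 1%N => //; exact: exec_skip.
- by move=> a e s _; exists (nsize a + nsize e).+1 => //; exact: exec_nset.
- by move=> a e s _; exists (nsize a + rsize e).+1 => //; exact: exec_rset.
- move=> p1 IH1 p2 IH2 s /andP[/IH1-/(_ s)[t1 e1 h1] /IH2-/(_ (run O p1 s))[t2 e2 h2]].
  by exists (t1 + t2)%N; [exact: exec_seq e1 e2 | exact: leq_add].
- move=> b p1 IH1 p2 IH2 s /andP[/IH1-/(_ s)[t1 e1 h1] /IH2-/(_ s)[t2 e2 h2]].
  case: ifPn => hb; [exists (bsize b + t1).+1 | exists (bsize b + t2).+1].
  + exact: exec_if_true.
  + by lia.
  + exact: exec_if_false.
  + by lia.
- move=> a b s _; exists (nsize a + nsize b + n + d).+1 => //; exact: exec_query.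
- move=> b s _; exists (nsize b + d).+1 => //; exact: exec_answer.
Qed.

(** * Shifted rounding of a real number to a grid *)

Section Rounding.
Variables (R : realType) (d0 : nat) (eps : R).

(** The forms [eps + eps] and [d0 + 1] mirror [width_rexp], so that evaluating the program produces
    this very term. *)
Definition cell_width : R := (eps + eps) * (d0 + 1)%:R.

Definition shifted (w : R) (e : nat) : R := w + (eps + eps) * e%:R.

(* No multiple of [cell_width] lies in (shifted w e - eps, shifted w e + eps]. *)
Definition stable (w : R) (e : nat) : bool :=
  Num.floor ((shifted w e + eps) / cell_width)
    <= Num.floor ((shifted w e - eps) / cell_width).

Definition round (w : R) (e : nat) : R :=
  (Num.floor (shifted w e / cell_width))%:~R * cell_width.

Hypothesis eps_gt0 : 0 < eps.

Lemma cell_width_gt0 : 0 < cell_width.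
Proof. by rewrite mulr_gt0 ?addr_gt0 // ltr0n addn1. Qed.

Lemma unstable_multiple w e : ~~ stable w e ->
  exists m : int, shifted w e - eps < m%:~R * cell_width <= shifted w e + eps.
Proof.
rewrite -ltNge => h; exists (Num.floor ((shifted w e + eps) / cell_width)).
rewrite -ltr_pdivrMr ?cell_width_gt0// -ler_pdivlMr ?cell_width_gt0//.
by rewrite -floor_lt_int h floor_le_tmp.
Qed.

(** Each unstable shift puts a grid point in a half-open window of width 2 eps around the shifted
    value. Comparing the two windows gives |(m - m') (d0 + 1) - (e - e')| < 1, so this integer is 0;
    since |e - e'| <= d0, both m = m' and e = e' follow. *)
Lemma unstable_unique w e e' : (e <= d0)%N -> (e' <= d0)%N ->
  ~~ stable w e -> ~~ stable w e' -> e = e'.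
Proof.
move=> he he' /unstable_multiple[m /andP[m1 m2]].
move=> /unstable_multiple[m' /andP[m1' m2']].
have eps2 : 0 < eps + eps by rewrite addr_gt0.
pose z : int := (m - m') * (d0 + 1)%N%:Z - (e%:Z - e'%:Z).
have zE : z%:~R * (eps + eps) =
    (m%:~R * cell_width - shifted w e) - (m'%:~R * cell_width - shifted w e').
  rewrite /z /shifted /cell_width rmorphB rmorphM !rmorphB /= -!pmulrn.
  by ring.
have z_lt : `|z%:~R * (eps + eps)| < 1%:~R * (eps + eps).
  by rewrite zE ltr_norml; apply/andP; split; lra.
move: z_lt; rewrite normrM (gtr0_norm eps2) ltr_pM2r// -intr_norm ltr_int.
rewrite /z => z_lt; have {z_lt} : (m - m') * (d0 + 1)%N%:Z = e%:Z - e'%:Z by lia.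
have [->|[q0|q0]] : m - m' = 0 \/ 1 <= m - m' \/ m - m' <= -1 by lia.
- by rewrite mul0r; lia.
- by move=> E; exfalso; nia.
- by move=> E; exfalso; nia.
Qed.

(** The shifted [mu] lies in the closed window of radius eps around the shifted [w], and stability
    makes the floor constant on that window. *)
Lemma stable_round w mu e : stable w e -> `|w - mu| <= eps ->
  round w e = round mu e.
Proof.
move=> st; rewrite ler_norml => /andP[h1 h2]; rewrite /round.
have g0 := cell_width_gt0.
have sandwich x : shifted w e - eps <= x <= shifted w e + eps ->
    Num.floor (x / cell_width) = Num.floor ((shifted w e - eps) / cell_width).
  move=> /andP[x1 x2]; apply/eqP; rewrite eq_le; apply/andP; split.
    apply: le_trans st; apply: le_floor; rewrite ler_pM2r ?invr_gt0//.
  by apply: le_floor; rewrite ler_pM2r ?invr_gt0.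
congr (_%:~R * _); rewrite !sandwich// /shifted; apply/andP; split; lra.
Qed.

(** The lower side decides the constant: rounding down loses less than 2 eps (d0 + 1) <= 4 eps d0,
    and [w] is off by at most eps <= eps d0. On the upper side the shift adds at most 2 eps d0. *)
Lemma round_close w mu e : (0 < d0)%N -> (e <= d0)%N -> `|w - mu| <= eps ->
  `|round w e - mu| <= 5%:R * (eps * d0%:R).
Proof.
move=> d0_gt0 he; rewrite !ler_norml => /andP[h1 h2].
have g0 := cell_width_gt0.
have r1 : round w e <= shifted w e by rewrite -ler_pdivlMr// floor_le_tmp.
have r2 : shifted w e < round w e + cell_width.
  rewrite /round -[X in _ < _ + X]mul1r -mulrDl -ltr_pdivrMr//.
  by have := floorD1_gt (shifted w e / cell_width); rewrite rmorphD.
have e1 : eps * e%:R <= eps * d0%:R by rewrite ler_pM2l// ler_nat.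
have e2 : eps <= eps * d0%:R by rewrite ler_pMr// ler1n.
have e3 : 0 <= eps * e%:R by rewrite mulr_ge0 ?ler0n ?ltW.
move: r1 r2; rewrite /shifted /cell_width natrD mulrDr !mulrDl => r1 r2.
by apply/andP; split; lra.
Qed.

End Rounding.

(** * The steward as a program *)

Definition ncell (c : nat) : nexp := NCell (NConst c).
Definition nincr (c : nat) : prog :=
  NSet (NConst c) (NAdd (ncell c) (NConst 1)).
Definition nlt (a b : nexp) : bexp := NLe (NAdd a (NConst 1)) b.

Definition eps_rexp : rexp := RCell (NConst 0).
Definition width_rexp : rexp :=
  RMul (RAdd eps_rexp eps_rexp) (ROfNat (NAdd (ncell 3) (NConst 1))).
Definition shift_rexp : rexp :=
  RAdd (RCell (NAdd (NConst 2) (ncell 7)))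
       (RMul (RAdd eps_rexp eps_rexp) (ROfNat (ncell 8))).
Definition stable_bexp : bexp :=
  RLe (RFloor (RDiv (RAdd shift_rexp eps_rexp) width_rexp))
      (RFloor (RDiv (RSub shift_rexp eps_rexp) width_rexp)).
Definition round_rexp : rexp :=
  RMul (RFloor (RDiv shift_rexp width_rexp)) width_rexp.

(* Cell 4 counts coins and cell 5 rounds.  In a round, cell 6 is the first
   coordinate of the current block, cell 7 the coordinate under examination and
   cell 8 the shift currently tried for the block.  The point X is in cells
   9, ..., 8+n, the value f_i(X) in real cells 2, ..., 1+d and the answer in
   real cells 2+d, ..., 1+2d. *)
Definition scan_step : prog :=
  If (NLe (NAdd (ncell 6) (ncell 3)) (ncell 7))
     (Seq (NSet (NConst 6) (ncell 7)) (NSet (NConst 8) (NConst 0)))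
     (If stable_bexp
         (Seq (RSet (NAdd (NAdd (NConst 2) (ncell 2)) (ncell 7)) round_rexp)
              (nincr 7))
         (Seq (nincr 8) (NSet (NConst 7) (ncell 6)))).

(** An unstable coordinate increments the shift and restarts the block from its first coordinate, so
    answers already written for the block get overwritten. *)
Definition scan : prog := While (nlt (ncell 7) (ncell 2)) scan_step.

Definition ask : prog :=
  Seq (Query (NConst 9) (NConst 2))
  (Seq (NSet (NConst 6) (NConst 0))
  (Seq (NSet (NConst 7) (NConst 0)) (NSet (NConst 8) (NConst 0)))).

Definition reply : prog :=
  Seq (Answer (NAdd (NConst 2) (ncell 2))) (nincr 5).

Definition rounds : prog :=
  While (nlt (ncell 5) (ncell 1)) (Seq ask (Seq scan reply)).

Definition toss : prog := Flip (NAdd (NConst 9) (ncell 4)).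

Definition flips : prog :=
  While (nlt (ncell 4) (ncell 0)) (Seq toss (nincr 4)).

Definition block_steward : prog := Seq flips rounds.

(** * Correctness and termination of the scan of one vector *)

Section Scan.
Variables (R : realType) (n d d0 : nat) (eps : R) (O : strategy R n d).
Hypotheses (d0_gt0 : (0 < d0)%N) (eps_gt0 : 0 < eps).
Variable s0 : state R d.
Hypotheses (s0_d : nmem s0 2 = d) (s0_d0 : nmem s0 3 = d0).
Hypotheses (s0_eps : rmem s0 0 = eps).

Let w (m : nat) : R := rmem s0 (2 + m).

Definition same_outside_scan (s : state R d) : Prop :=
  [/\ forall c, (c < 6)%N || (8 < c)%N -> nmem s c = nmem s0 c,
      forall c, (c < 2 + d)%N -> rmem s c = rmem s0 c,
      coins s = coins s0, answers s = answers s0 & queries s = queries s0].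

Definition scan_result (F : nat -> nat) (r : nat) (s : state R d) : Prop :=
  (forall b, (F b <= d0)%N) /\
  forall m, (m < r)%N -> stable d0 eps (w m) (F (m %/ d0)%N) /\
    rmem s (2 + d + m) = round d0 eps (w m) (F (m %/ d0)%N).

(** The clause on [e] records why every smaller shift was rejected; it feeds the pigeonhole argument
    that keeps the shift at most [d0]. *)
Definition scan_inv (s : state R d) : Prop :=
  [/\ same_outside_scan s,
      [/\ d0 %| nmem s 6, nmem s 6 <= nmem s 7, nmem s 7 <= d &
          nmem s 7 <= nmem s 6 + d0]%N,
      (nmem s 8 <= d0)%N,
      forall e, (e < nmem s 8)%N -> exists m,
        (nmem s 6 <= m < nmem s 6 + d0)%N /\ ~~ stable d0 eps (w m) e &
      exists F, scan_result F (nmem s 7) s /\ F (nmem s 6 %/ d0)%N = nmem s 8].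

(** A lexicographic order (block, shift, coordinate) packed into one number. Under the invariant the
    last term is at most d0 and the last two together at most (d0 + 1)^2 + d0 < (d0 + 2) (d0 + 1),
    which explains the weights. *)
Definition scan_measure (s : state R d) : nat :=
  (d - nmem s 6) * ((d0 + 2) * (d0 + 1)) + (d0 + 1 - nmem s 8) * (d0 + 1)
  + (nmem s 6 + d0 - nmem s 7).

(* Distinct shifts are unstable at distinct coordinates, so a block of [d0]
   coordinates cannot make all [d0 + 1] shifts unstable. *)
Lemma block_pigeonhole (v : nat -> R) (j : nat) :
  ~ (forall e, (e <= d0)%N -> exists m,
       (j <= m < j + d0)%N /\ ~~ stable d0 eps (v m) e).
Proof.
move=> H.
have /choice[f hf] : forall e : 'I_d0.+1, exists m : 'I_d0,
    ~~ stable d0 eps (v (j + m)%N) e.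
  move=> e; have [m [/andP[h1 h2] h3]] := H e (ltn_ord e).
  have hm : (m - j < d0)%N by lia.
  by exists (Ordinal hm); rewrite /= subnKC.
have inj_f : injective f.
  move=> e e' E; apply: val_inj.
  apply: (unstable_unique eps_gt0 (leq_ord e) (leq_ord e') (hf e)).
  by rewrite E.
by have := leq_card _ inj_f; rewrite !card_ord ltnn.
Qed.

Lemma div_block (j m : nat) : (d0 %| j)%N -> (j <= m < j + d0)%N ->
  (m %/ d0 = j %/ d0)%N.
Proof.
move=> dj /andP[h1 h2]; rewrite -(subnKC h1) divnDl// [X in (_ + X)%N]divn_small ?addn0//.
by lia.
Qed.

Lemma ltn_div_block (j m : nat) : (d0 %| j)%N -> (m < j)%N ->
  (m %/ d0 < j %/ d0)%N.
Proof. by move=> dj h; rewrite ltn_divLR// divnK. Qed.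

Lemma scan_step_inv s : scan_inv s -> (nmem s 7 < d)%N ->
  scan_inv (run O scan_step s) /\
  (scan_measure (run O scan_step s) < scan_measure s)%N.
Proof.
move=> [[fn fr fc fa fq] [dj jl ld ljd] ed0 he [F [[Fd0 hF] Fj]]] lt_ld.
have d_s : nmem s 2 = d by rewrite fn.
have d0_s : nmem s 3 = d0 by rewrite fn.
have eps_s : rmem s 0 = eps by rewrite fr.
have w_s : rmem s (2 + nmem s 7) = w (nmem s 7) by rewrite fr// ltn_add2l.
rewrite /scan_step [run _ _ _]/= d0_s.
case: ifPn => [hjl|hjl].
  have {}hjl : nmem s 7 = (nmem s 6 + d0)%N by lia.
  have dl : (d0 %| nmem s 7)%N by rewrite hjl dvdn_addl.
  split; last first.
    (* Moving to the next block frees d0 >= 1 copies of the weight, enough to pay for resetting the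
       shift and the coordinate. *)
    have dj' : ((d - nmem s 6) * ((d0 + 2) * (d0 + 1)) = (d - nmem s 7) *
        ((d0 + 2) * (d0 + 1)) + d0 * ((d0 + 2) * (d0 + 1)))%N.
      by rewrite -mulnDl; congr (_ * _)%N; lia.
    have := leq_pmull ((d0 + 2) * (d0 + 1)) d0_gt0.
    rewrite /scan_measure /= dj' subn0.
    set a := ((d - _) * _)%N; set b := ((_ - nmem s 8) * _)%N.
    by move: a b => a b; lia.
  split.
  - split=> //= c hc; rewrite !ifF ?fn//; apply/eqP; lia.
  - by rewrite /= leqnn leq_addr dl (ltnW lt_ld).
  - by [].
  - by [].
  pose F' := [eta F with (nmem s 7 %/ d0)%N |-> 0%N].
  exists F'; split; last by rewrite /F' /= eqxx.
  split=> [b|m hm]; first by rewrite /F' /=; case: ifP.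
  have := ltn_div_block dl hm; rewrite /F' /= => /ltn_eqF ->.
  exact: hF.
rewrite -ltnNge in hjl.
rewrite [X in if X then _ else _](_ : _ = stable d0 eps (w (nmem s 7)) (nmem s 8)); last by rewrite eps_s w_s ler_int.
case: ifPn => st.
  split; last by rewrite /scan_measure /=; lia.
  split.
  - split=> //= [c hc|c hc]; first by rewrite !ifF ?fn//; apply/eqP; lia.
    by rewrite d_s ifF ?fr//; apply/eqP; lia.
  - by rewrite /=; split=> //; lia.
  - by [].
  - by [].
  have lj : (nmem s 7 %/ d0 = nmem s 6 %/ d0)%N by apply: div_block => //; lia.
  exists F; split; last by [].
  split=> // m; rewrite /= addn1 ltnS leq_eqVlt d_s => /predU1P[->|hm].
    by rewrite lj Fj eqxx eps_s w_s.
  rewrite ifF; first exact: hF.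
  by apply/eqP; lia.
(* If the current shift were already [d0], its failure would complete a list of d0 + 1 shifts all
   unstable within one block. *)
have ed : (nmem s 8 < d0)%N.
  rewrite ltn_neqAle ed0 andbT; apply/eqP => e_d0.
  apply: (@block_pigeonhole w (nmem s 6)) => e.
  rewrite -[X in (_ <= X)%N]e_d0 leq_eqVlt => /predU1P[->|]; last exact: he.
  by exists (nmem s 7); split=> //; lia.
split; last first.
  have E : (d0 + 1 - nmem s 8 = (d0 + 1 - (nmem s 8 + 1)) + 1)%N by lia.
  rewrite /scan_measure /= E [((_ + 1) * _)%N in X in (_ < X)%N]mulnDl.
  set a := ((d - _) * _)%N; set b := ((d0 + 1 - _) * _)%N.
  by move: a b => a b; lia.
split.
- by split=> //= c hc; rewrite !ifF ?fn//; apply/eqP; lia.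
- by rewrite /= leqnn leq_addr dj (leq_trans jl ld).
- by rewrite /= addn1.
- move=> e; rewrite /= addn1 ltnS leq_eqVlt => /predU1P[->|]; last exact: he.
  by exists (nmem s 7); split=> //; lia.
(* Only the current block changes its shift; its coordinates are no longer claimed as done, and
   earlier blocks have a smaller index. *)
pose F' := [eta F with (nmem s 6 %/ d0)%N |-> (nmem s 8).+1].
exists F'; split; last by rewrite /F' /= eqxx addn1.
split=> [b|m /= hm]; first by rewrite /F' /=; case: ifP.
have := ltn_div_block dj hm; rewrite /F' /= => /ltn_eqF ->.
by apply: hF; exact: leq_trans hm jl.
Qed.

End Scan.

(** The initial measure plus one, times the cost of an iteration. [cost 0 0] is exact because
    [scan_step] transfers no point or vector. *)
Definition scan_bound (d d0 : nat) : nat :=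
  (d * ((d0 + 2) * (d0 + 1)) + (d0 + 1) * (d0 + 1) + d0).+1
  * (bsize (nlt (ncell 7) (ncell 2)) + cost 0 0 scan_step).+1.

(** * The complete run of the steward *)

Section Runs.
Variables (R : realType) (n k d d0 : nat) (eps : R) (O : strategy R n d).
Hypotheses (d0_gt0 : (0 < d0)%N) (eps_gt0 : 0 < eps).
Implicit Types (s : state R d).

Lemma wp_scan s0 :
  nmem s0 2 = d -> nmem s0 3 = d0 -> rmem s0 0 = eps ->
  nmem s0 6 = 0%N -> nmem s0 7 = 0%N -> nmem s0 8 = 0%N ->
  wp O scan (scan_bound d d0) s0 (fun s => same_outside_scan s0 s /\
    exists F, scan_result d0 eps s0 F d s).
Proof.
move=> hd hd0 heps h6 h7 h8.
have inv0 : scan_inv d0 eps s0 s0.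
  split; rewrite ?h6 ?h7 ?h8//.
  exists (fun=> 0%N); split=> //.
have -> : scan_bound d d0 = ((scan_measure d0 s0).+1 *
    (bsize (nlt (ncell 7) (ncell 2)) + cost n d scan_step).+1)%N.
  by rewrite /scan_measure h6 h7 h8 !subn0 add0n.
apply: wp_consequence (wp_while (I := scan_inv d0 eps s0) _ inv0) (leqnn _) _.
  move=> s inv; have [[fn _ _ _ _] _ _ _ _] := inv.
  rewrite /= addn1 (fn 2%N)// hd => lt_ld.
  by apply: wp_straight => //; exact: scan_step_inv.
move=> s [[same [_ _ ld _] _ _ [F [resF _]]]].
have [fn _ _ _ _] := same.
rewrite /= addn1 (fn 2%N)// hd -leqNgt => dl; split=> //; exists F.
have l_d : nmem s 7 = d by apply/eqP; rewrite eqn_leq ld.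
by rewrite l_d in resF.
Qed.

(** A finite type, so that possible answers can be counted; the successor makes room for a last,
    partial block. *)
Definition shifts : Type := {ffun 'I_(d %/ d0).+1 -> 'I_d0.+1}.

Definition round_vector (v : 'rV[R]_d) (D : shifts) : 'rV[R]_d :=
  \row_j round d0 eps (v ord0 j) (D (inord (j %/ d0))).

Definition rounded (v y : 'rV[R]_d) : Prop :=
  exists2 D : shifts,
    forall j, stable d0 eps (v ord0 j) (D (inord (j %/ d0))) &
    y = round_vector v D.

(** The interface to the probabilistic argument, which uses only this property and the number of
    answers. *)
Definition transcript_ok (X : n.-tuple bool) (a : seq 'rV[R]_d) : Prop :=
  forall i, (i < size a)%N -> rounded ((O (take i a)).1 X) (nth 0 a i).

Lemma transcript_ok_rcons X a y :
  transcript_ok X a -> rounded ((O a).1 X) y -> transcript_ok X (rcons a y).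
Proof.
move=> ha hy i; rewrite size_rcons ltnS leq_eqVlt => /predU1P[->|hi].
  by rewrite -cats1 takel_cat// take_size nth_cat ltnn subnn.
by rewrite -cats1 takel_cat ?(ltnW hi)// nth_cat hi; exact: ha.
Qed.

Definition rounds_inv (X : n.-tuple bool) s : Prop :=
  [/\ [/\ nmem s 1 = k, nmem s 2 = d & nmem s 3 = d0],
      rmem s 0 = eps /\ read_point n s 9 = X,
      nmem s 5 = size (answers s) /\ (nmem s 5 <= k)%N,
      queries s = iota 0 (nmem s 5) &
      transcript_ok X (answers s)].

Definition round_bound : nat :=
  cost n d ask + (scan_bound d d0 + cost n d reply).

Lemma write_vectorE (m : nat -> R) (b : nat) (v : 'rV[R]_d) (j : 'I_d) :
  write_vector m b v (b + j) = v ord0 j.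
Proof. by rewrite /write_vector leq_addr addKn insubT //= => h; congr (v _ _); apply: val_inj. Qed.

Lemma write_vector_outside (m : nat -> R) (b : nat) (v : 'rV[R]_d) (c : nat) :
  (c < b)%N -> write_vector m b v c = m c.
Proof. by rewrite /write_vector ltnNge => /negbTE ->. Qed.

Lemma wp_round X s : rounds_inv X s -> (nmem s 5 < k)%N ->
  wp O (Seq ask (Seq scan reply)) round_bound s
    (fun s' => rounds_inv X s' /\ (k - nmem s' 5 < k - nmem s 5)%N).
Proof.
move=> [[h1 h2 h3] [heps hX] [h5 _] hq ha] lt_k.
apply: wp_seq; apply: wp_straight => //.
have [W defW] : exists W, W = (O (answers s)).1 X by exists ((O (answers s)).1 X).
set s1 := run O ask s.
have s1w (j : 'I_d) : rmem s1 (2 + j) = W ord0 j.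
  by rewrite /s1 /= hX -defW write_vectorE.
have s1eps : rmem s1 0 = eps by rewrite /s1 /= write_vector_outside.
have s1X : read_point n s1 9 = X by rewrite -hX; apply: eq_from_tnth => i; rewrite !tnth_mktuple.
apply: wp_seq.
apply: wp_consequence (wp_scan (s0 := s1) h2 h3 s1eps erefl erefl erefl) (leqnn _) _.
move=> s2 [[fn fr fc fa fq] [F [Fd0 resF]]].
apply: wp_straight => //=.
have s2_2 : nmem s2 2 = d by rewrite fn.
have s2_5 : nmem s2 5 = nmem s 5 by rewrite fn.
split; last by rewrite s2_5 /=; lia.
split=> /=.
- by rewrite !fn.
- split; first by rewrite fr.
  rewrite -s1X; apply: eq_from_tnth => i; rewrite !tnth_mktuple /=.
  by rewrite fn ?orbT.
- by rewrite size_rcons fa s2_5 h5 addn1 -h5.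
- by rewrite fq s2_5 iotaD cats1 -hq h5.
rewrite fa; apply: transcript_ok_rcons => //; rewrite -defW.
(* [inord] loses nothing here, since every [F b] is at most [d0] and every block index at most
   [d %/ d0]. *)
exists [ffun b : 'I_(d %/ d0).+1 => inord (F b)] => [j|].
  rewrite ffunE !inordK ?ltnS ?leq_div2r ?(ltnW (ltn_ord j))// -s1w.
  by have [] := resF j (ltn_ord j).
apply/rowP => j; rewrite !mxE ffunE !inordK ?ltnS ?leq_div2r ?(ltnW (ltn_ord j))//.
rewrite -s1w s2_2.
by have [_] := resF j (ltn_ord j).
Qed.

Lemma wp_rounds X s : rounds_inv X s -> nmem s 5 = 0%N ->
  wp O rounds (k.+1 * (bsize (nlt (ncell 5) (ncell 1)) + round_bound).+1) s
    (fun s' => rounds_inv X s' /\ nmem s' 5 = k).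
Proof.
move=> inv h5.
have hm : (k - nmem s 5 = k)%N by rewrite h5 subn0.
rewrite -[X in (X.+1 * _)%N]hm.
apply: wp_consequence
  (wp_while (I := rounds_inv X) (m := fun s => (k - nmem s 5)%N) _ inv) (leqnn _) _.
  move=> s' inv'; have [[h1 _ _] _ _ _ _] := inv'.
  by rewrite /= addn1 h1 => lt_k; exact: wp_round.
move=> s' [inv']; have [[h1 _ _] _ [_ le_k] _ _] := inv'.
rewrite /= addn1 h1 -leqNgt => ge_k; split=> //.
by apply/eqP; rewrite eqn_leq le_k.
Qed.

Definition flips_inv (tape : n.-tuple bool) s : Prop :=
  [/\ forall c, (c < 9)%N -> c != 4 -> nmem s c = nth 0%N [:: n; k; d; d0] c,
      (nmem s 4 <= n)%N /\ coins s = drop (nmem s 4) tape,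
      forall m, (m < nmem s 4)%N -> nmem s (9 + m) = nth false tape m,
      rmem s 0 = eps & answers s = [::] /\ queries s = [::]].

Definition flip_bound : nat := (nsize (NAdd (NConst 9) (ncell 4))).+1 + cost 0 0 (nincr 4).

Lemma wp_flip tape s : flips_inv tape s -> (nmem s 4 < n)%N ->
  wp O (Seq toss (nincr 4)) flip_bound s
    (fun s' => flips_inv tape s' /\ (n - nmem s' 4 < n - nmem s 4)%N).
Proof.
move=> [hn [_ hc] hX heps [ha hq]] lt_n.
move: hc; rewrite (drop_nth false) ?size_tuple// => hc.
apply: wp_seq; eexists; eexists; split; [exact: exec_flip hc | by [] |].
apply: (wp_straight (p := nincr 4)) => //=.
split; last by lia.
split=> //=.
- by move=> c c9 c4; rewrite (negbTE c4) ifF ?(hn c)//; apply/eqP; lia.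
- by rewrite addn1.
move=> m; rewrite addn1 ltnS leq_eqVlt => /predU1P[->|hm]; first by rewrite eqxx.
by rewrite ifF ?hX //; apply/eqP; lia.
Qed.

Lemma wp_flips (delta : R) (tape : n.-tuple bool) :
  wp O flips (n.+1 * (bsize (nlt (ncell 4) (ncell 0)) + flip_bound).+1)
    (initial n k d d0 eps delta tape)
    (fun s => rounds_inv tape s /\ nmem s 5 = 0%N).
Proof.
set s0 := initial _ _ _ _ _ _ _.
have inv0 : flips_inv tape s0 by split=> //=; rewrite drop0.
have hm : (n - nmem s0 4 = n)%N by rewrite /= subn0.
rewrite -[X in (X.+1 * _)%N]hm.
apply: wp_consequence
  (wp_while (I := flips_inv tape) (m := fun s => (n - nmem s 4)%N) _ inv0) (leqnn _) _.
  move=> s' inv'; have [hn _ _ _ _] := inv'.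
  by rewrite /= addn1 (hn 0%N)// => lt_n; exact: wp_flip.
move=> s' [[hn [le_n _] hX heps [ha hq]]].
rewrite /= addn1 (hn 0%N)//= -leqNgt => ge_n.
have {le_n ge_n} h4 : nmem s' 4 = n by apply/eqP; rewrite eqn_leq le_n.
split; last by rewrite hn.
split; rewrite ?hn// ?ha ?hq//.
split=> //; apply: eq_from_tnth => i; rewrite tnth_mktuple hX ?h4//.
by rewrite (tnth_nth false); case: (nth _ _ _).
Qed.

Definition steward_bound : nat :=
  n.+1 * (bsize (nlt (ncell 4) (ncell 0)) + flip_bound).+1 +
  k.+1 * (bsize (nlt (ncell 5) (ncell 1)) + round_bound).+1.

Lemma block_steward_run (delta : R) (tape : n.-tuple bool) :
  wp O block_steward steward_bound (initial n k d d0 eps delta tape)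
    (fun s => [/\ size (answers s) = k, uniq (queries s) &
                  transcript_ok tape (answers s)]).
Proof.
apply: wp_seq; apply: wp_consequence (wp_flips delta tape) (leqnn _) _ => s [inv h5].
apply: wp_consequence (wp_rounds inv h5) (leqnn _) _.
move=> s' [[_ _ [<- _] -> ht] hk]; split=> //.
by rewrite iota_uniq.
Qed.

End Runs.

(** * The union bound over the tree of answers *)

Lemma row_norm_leP (R : realType) (d : nat) (v : 'rV[R]_d) (e : R) : 0 <= e ->
  reflect (forall j, `|v ord0 j| <= e) (`|v| <= e).
Proof.
move=> e0; rewrite [X in X <= _]/Num.norm /= mx_normrE.
apply: (iffP (bigmax_leP _ _ _ _)) => /= [[_ h] j|h]; first exact: (h (ord0, j)).
by split=> // -[i j] _ /=; rewrite (ord1 i).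
Qed.

Section UnionBound.
Variables (R : realType) (n d d0 : nat) (eps delta : R) (O : strategy R n d).
Hypotheses (d0_gt0 : (0 < d0)%N).

Definition far_points (h : seq 'rV[R]_d) : {set n.-tuple bool} :=
  [set X | eps < `|(O h).1 X - (O h).2|].

(* As long as X is not far, the answers are roundings of the mu_i, so they
   follow a tree whose shape does not depend on X. *)
Fixpoint bad_points (k : nat) (h : seq 'rV[R]_d) : {set n.-tuple bool} :=
  if k is k'.+1 then
    far_points h :|: \bigcup_(D : shifts d d0)
      bad_points k' (rcons h (round_vector eps (O h).2 D))
  else finset.set0.

Lemma card_shifts : #|{: shifts d d0}| = (d0.+1 ^ (d %/ d0).+1)%N.
Proof. by rewrite card_ffun !card_ord. Qed.

(** With b children per node, the 1 + b + ... + b^(k-1) nodes contribute at most delta 2^n points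
    each. As b >= 2, that sum is at most b^k - 1; the -1 is what lets the induction absorb the root.
    [K] stays fixed so that admissibility covers every node. *)
Lemma card_bad_points K k h :
  0 < delta -> admissible K eps delta O -> (size h + k <= K)%N ->
  #|bad_points k h|%:R <=
    ((#|{: shifts d d0}| ^ k)%:R - 1) * (delta * (2 ^ n)%:R).
Proof.
move=> delta_gt0 adm; elim: k h => [|k IH] h hK.
  by rewrite /= finset.cards0 subrr mul0r.
set b := #|{: shifts d d0}|; set c := delta * _.
have c0 : 0 <= c by rewrite mulr_ge0 ?ler0n ?ltW.
have b2 : (2 <= b)%N.
  by rewrite /b card_shifts (leq_trans _ (leq_pexp2l _ (ltn0Sn _)))// expn1.
have far : #|far_points h|%:R <= c.
  have := adm h; rewrite /concentrated ler_pdivrMr ?ltr0n ?expn_gt0//.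
  by apply; lia.
have step : (#|\bigcup_(D : shifts d d0)
      bad_points k (rcons h (round_vector eps (O h).2 D))|%:R : R)
    <= b%:R * (((b ^ k)%:R - 1) * c).
  apply: (@le_trans _ _ (\sum_(D : shifts d d0)
      #|bad_points k (rcons h (round_vector eps (O h).2 D))|%:R)).
    by rewrite -natr_sum ler_nat; exact: card_big_setU.
  rewrite mulr_natl -sumr_const; apply: ler_sum => D _; apply: IH.
  by rewrite size_rcons addSnnS.
have le_b : 1 * c <= (b%:R - 1) * c.
  have b2R : 2 <= b%:R :> R by rewrite ler_nat.
  by apply: ler_wpM2r => //; lra.
rewrite [bad_points _ _]/=.
apply: (le_trans (y := c + b%:R * (((b ^ k)%:R - 1) * c))).
  apply: le_trans (lerD far step); rewrite -natrD ler_nat.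
  by rewrite cardsU leq_subr.
by rewrite expnS natrM; nra.
Qed.

Hypothesis eps_gt0 : 0 < eps.

Lemma rounded_near (v mu y : 'rV[R]_d) :
  `|v - mu| <= eps -> rounded d0 eps v y ->
  exists2 D : shifts d d0, y = round_vector eps mu D &
    `|y - mu| <= 5%:R * (eps * d0%:R).
Proof.
move=> /row_norm_leP-/(_ (ltW eps_gt0)) h [D st ->]; exists D.
  apply/rowP => j; rewrite !mxE; apply: stable_round => //.
  by have := h j; rewrite !mxE.
apply/row_norm_leP => [|j]; first by rewrite !mulr_ge0 ?ler0n ?ltW.
rewrite !mxE; apply: round_close => //; first exact: leq_ord.
by have := h j; rewrite !mxE.
Qed.

(** Induction along the transcript, with [h] the history. Either X is far at [h], or the first
    answer is a rounding of mu, hence accurate and a child of [h]; the failure then lies further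
    down. *)
Lemma failure_bad_points X a h :
  (forall i, (i < size a)%N ->
     rounded d0 eps ((O (h ++ take i a)).1 X) (nth 0 a i)) ->
  (exists2 i, (i < size a)%N &
     5%:R * (eps * d0%:R) < `|nth 0 a i - (O (h ++ take i a)).2|) ->
  X \in bad_points (size a) h.
Proof.
elim: a h => [|y a IH] h ok [i] //= hi far; rewrite !inE.
have [//|near] := ltP; apply/orP; right.
have [|D yD y_mu] := rounded_near near (y := y).
  by have := ok 0%N isT; rewrite /= cats0.
apply/finset.bigcupP; exists D => //; rewrite -yD; apply: IH.
  by move=> j hj; have := ok j.+1 hj; rewrite /= cat_rcons.
case: i hi far => [_|i hi far].
  by rewrite /= cats0 ltNge y_mu.
by exists i => //; rewrite cat_rcons.
Qed.

End UnionBound.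

(** The sum of probabilities is the expectation of the number of events that occur. This reduces a
    randomized owner to each fixed deterministic one. *)
Lemma sum_probability_le (disp : measure_display) (T : measurableType disp) (R : realType)
    (P : probability T R) (I : finType) (F : I -> set T) (c : R) :
  (forall i, measurable (F i)) ->
  (forall w, (\sum_(i : I) \1_(F i) w : R) <= c) ->
  (\sum_(i : I) P (F i) <= c%:E)%E.
Proof.
move=> mF hc.
have -> : (\sum_(i : I) P (F i) =
    \int[P]_(w in setT) \sum_(i : I) (\1_(F i) w)%:E)%E.
  rewrite ge0_integral_sum//.
  - by apply: eq_bigr => i _; rewrite integral_indic// setIT.
  - by move=> i; apply/measurable_EFinP; exact: measurable_indic.
have -> : c%:E = (\int[P]_(w in setT) cst c%:E w)%E.
  by rewrite integral_cst// -[LHS]mule1 -(probability_setT P).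
apply: ge0_le_integral => //.
- by move=> w _; apply: sume_ge0 => i _; rewrite lee_fin.
- apply: emeasurable_sum => i; apply/measurable_EFinP; exact: measurable_indic.
- by move=> w _; rewrite sumEFin lee_fin.
Qed.

(** * Explicit bounds on running time and failure probability *)

Definition steward_constant : nat :=
  (bsize (nlt (ncell 4) (ncell 0)) + flip_bound).+1
  + (bsize (nlt (ncell 5) (ncell 1)) + cost 0 0 ask
     + 4 * (bsize (nlt (ncell 7) (ncell 2)) + cost 0 0 scan_step).+1
     + cost 0 0 reply + 5).

Lemma scan_bound_le (d d0 : nat) : (d0 <= d)%N ->
  (scan_bound d d0 <= 4 * d.+1 ^ 3 *
    (bsize (nlt (ncell 7) (ncell 2)) + cost 0 0 scan_step).+1)%N.
Proof.
move=> d0d; rewrite /scan_bound leq_mul2r; apply/orP; right.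
have h1 : (d * ((d0 + 2) * (d0 + 1)) <= 2 * d.+1 ^ 3)%N.
  have -> : (2 * d.+1 ^ 3 = d.+1 * ((2 * d.+1) * d.+1))%N by ring.
  by apply: leq_mul; [lia | apply: leq_mul; lia].
have h2 : ((d0 + 1) * (d0 + 1) <= d.+1 ^ 2)%N by apply: leq_mul; lia.
have h3 : (d.+1 ^ 2 <= d.+1 ^ 3)%N by rewrite leq_pexp2l.
have h4 : (d.+1 <= d.+1 ^ 3)%N by rewrite -[leqLHS]expn1 leq_pexp2l.
set a := (d * _)%N in h1 *; set b := ((d0 + 1) * (d0 + 1))%N in h2 *.
set c := (_ ^ 3)%N in h1 h3 h4 *; set e := (_ ^ 2)%N in h2 h3 *.
by move: a b c e h1 h2 h3 h4 => a b c e; lia.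
Qed.

(** The main loop is charged k + 1 iterations, each at most cubic in the inputs, whence the exponent
    4. *)
Lemma steward_bound_le (n k d d0 : nat) : (d0 <= d)%N ->
  (steward_bound n k d d0 <= steward_constant * (1 + n + k + d) ^ 4)%N.
Proof.
move=> d0d; rewrite /steward_bound /round_bound /steward_constant.
have -> : cost n d ask = (cost 0 0 ask + (n + d))%N by rewrite /=; lia.
have -> : cost n d reply = (cost 0 0 reply + d)%N by rewrite /=; lia.
have := scan_bound_le d0d.
set a := (_ + flip_bound).+1; set b := bsize (nlt (ncell 5) _).
set u := cost 0 0 ask; set v := cost 0 0 reply; set c := (_ + cost 0 0 _).+1.
set x := scan_bound _ _; set S := (1 + n + k + d)%N.
have S1 : (1 <= S)%N by [].
have S3 : (1 <= S ^ 3)%N by rewrite expn_gt0.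
have SS3 : (S <= S ^ 3)%N by rewrite -[leqLHS]expn1 leq_pexp2l.
have SS4 : (S <= S ^ 4)%N by rewrite -[leqLHS]expn1 leq_pexp2l.
have dS3 : (d.+1 ^ 3 <= S ^ 3)%N by rewrite leq_exp2r // /S; lia.
move=> hx.
have {}hx : (x <= 4 * c * S ^ 3)%N.
  by apply: leq_trans hx _; rewrite mulnAC leq_mul2l dS3 orbT.
have bS : (b <= b * S ^ 3)%N by rewrite leq_pmulr.
have uS : (u <= u * S ^ 3)%N by rewrite leq_pmulr.
have vS : (v <= v * S ^ 3)%N by rewrite leq_pmulr.
have inner : ((b + (u + (n + d) + (x + (v + d)))).+1
    <= (b + u + 4 * c + v + 5) * S ^ 3)%N.
  have ndS : (n + d + d <= 2 * S)%N by rewrite /S; lia.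
  rewrite -mulnA in hx; move: hx bS uS vS SS3 S3 ndS.
  clear; clearbody S b u v c x; move: (S ^ 3)%N => T.
  by rewrite !mulnDl; lia.
rewrite mulnDl; apply: leq_add.
  by rewrite mulnC leq_mul2l (leq_trans _ SS4) ?orbT // /S; lia.
rewrite [X in (_ <= _ * X)%N]expnS mulnCA; apply: leq_mul inner.
by rewrite /S; lia.
Qed.

(** The factor 2 comes from the number of blocks: d / d0 + 1 <= 2 d / d0 because d0 <= d. *)
Lemma shifts_growth (R : realType) (k d d0 : nat) :
  (0 < d0)%N -> (d0 <= d)%N ->
  (#|{: shifts d d0}| ^ k)%:R
    <= expR (2%:R * (k%:R * d%:R * ln (d0.+1)%:R / d0%:R)) :> R.
Proof.
move=> d0_gt0 d0d; rewrite card_shifts -expnM natrX.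
have h0 : (0 : R) < d0.+1%:R by rewrite ltr0n.
rewrite -{1}(lnK (R := R) (x := d0.+1%:R)) ?posrE// -expRM_natl ler_expR.
have ln0 : 0 <= ln (d0.+1%:R : R) by rewrite ln_ge0// ler1n.
have blocks : (d %/ d0).+1%:R <= 2%:R * (d%:R / d0%:R) :> R.
  rewrite mulrA ler_pdivlMr ?ltr0n// -!natrM ler_nat.
  by have := leq_trunc_div d d0; rewrite mulSn mul2n -addnn; lia.
have -> : 2%:R * (k%:R * d%:R * ln d0.+1%:R / d0%:R) =
    (2%:R * (d%:R / d0%:R)) * (k%:R * ln d0.+1%:R) :> R by ring.
by rewrite natrM -mulrA; apply: ler_wpM2r; rewrite ?mulr_ge0.
Qed.

Theorem theorem5p3 (R : realType) :
  exists (steward : prog) (C : R) (e : nat),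
    forall (n k d d0 : nat) (eps delta : R),
      (0 < d0)%N -> (d0 <= d)%N -> 0 < eps -> 0 < delta ->
      exists delta' : R,
        [/\ delta' <= expR (C * (k%:R * d%:R * ln (d0.+1)%:R / d0%:R)) * delta,
            is_steward n k d d0 eps delta (C * (eps * d0%:R)) delta' n steward,
            one_query n k d d0 eps delta n steward
          & time_at_most n k d d0 eps delta
              (C * (1 + n%:R + k%:R + d%:R + Num.max 0 (ln eps^-1)) ^+ e)
              n steward].
Proof.
(* One constant serves three times: as accuracy factor (at least 5), as factor in the exponent (at
   least 2) and as time factor. *)
exists block_steward, steward_constant%:R, 4%N.
move=> n k d d0 eps delta d0_gt0 d0d eps_gt0 delta_gt0.
have C5 : 5%:R <= steward_constant%:R :> R by rewrite ler_nat /steward_constant; lia.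
have runP (O : strategy R n d) (tape : n.-tuple bool) : exists t s,
    [/\ runs_to k d0 eps delta block_steward O tape t s,
        (t <= steward_bound n k d d0)%N &
        [/\ size (answers s) = k, uniq (queries s) &
            transcript_ok d0 eps O tape (answers s)]].
  exact: (@block_steward_run R n k d d0 eps O d0_gt0 eps_gt0 delta tape).
exists ((#|{: shifts d d0}| ^ k)%:R * delta); split.
- rewrite ler_pM2r//; apply: le_trans (shifts_growth R k d0_gt0 d0d) _.
  rewrite ler_expR; apply: ler_wpM2r; last by lra.
  by rewrite !mulr_ge0 ?invr_ge0 ?ler0n ?ln_ge0 ?ler1n.
- split=> [owner tape _|disp T P O failure adm meas].
    by have [t [s [run_s _ [sz _ _]]]] := runP owner tape; exists t, s.
  set b := (_ ^ k)%:R.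
  have c0 : (2 ^ n)%:R != 0 :> R by rewrite pnatr_eq0 -lt0n expn_gt0.
  (* Factoring out 2^-n turns the claim into a bound on the expected number of failing tapes. *)
  have -> : (b * delta)%:E =
      (((2 ^ n)%:R^-1)%:E * (b * (delta * (2 ^ n)%:R))%:E)%E.
    by rewrite -EFinM; congr EFin; field.
  apply: lee_wpmul2l; first by rewrite lee_fin invr_ge0.
  apply: sum_probability_le => // w.
  have := card_bad_points d0_gt0 delta_gt0 (adm w) (leqnn (size [::] + k)).
  move=> /le_trans-/(_ (b * (delta * (2 ^ n)%:R))) card_bad.
  apply: le_trans (card_bad _); last first.
    by rewrite mulrBl mul1r gerBl mulr_ge0// ltW.
  (* For fixed [w], the indicators are compared tape by tape: each failing tape is a bad point of
     the deterministic owner [O w]. *)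
  rewrite -sum1_card natr_sum [leRHS]big_mkcond; apply: ler_sum => tape _.
  rewrite indicE; have [|_] := boolP (w \in failure tape); last by case: ifP.
  rewrite inE => -[t [s [run_s [i ik far]]]].
  have [t' [s' [run_s' _ [sz _ ok]]]] := runP (O w) tape.
  have [_ E] := exec_deterministic run_s run_s'; rewrite {}E in far.
  rewrite ifT// -sz; apply: failure_bad_points => //.
  exists i; rewrite ?sz//=; apply: le_lt_trans far.
  by rewrite ler_wpM2r// mulr_ge0// ltW.
- move=> O tape t s _ run_s.
  have [t' [s' [run_s' _ [_ uq _]]]] := runP O tape.
  by have [_ ->] := exec_deterministic run_s run_s'.
move=> O tape t s _ run_s.
have [t' [s' [run_s' le_t _]]] := runP O tape.
have [-> _] := exec_deterministic run_s run_s'.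
apply: (@le_trans _ _ (steward_constant * (1 + n + k + d) ^ 4)%:R).
  by rewrite ler_nat; exact: leq_trans le_t (steward_bound_le _ _ d0d).
rewrite natrM natrX; apply: ler_wpM2l => //.
rewrite !natrD; apply: lerXn2r; rewrite ?nnegrE ?addr_ge0 ?le_max ?lexx//.
by rewrite lerDl le_max lexx.
Qed.
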